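(* For every totally positive $A\in\mathcal{SS}_n^{>0}$ and every subset $I\subseteq[n]$ of even size, \[ \operatorname{sgn}(\mathrm{Pf}_I(A))=(-1)^{\sum_{i\in I}i-\binom{|I|+1}{2}}=:\operatorname{sgn}(I,[n]); \] in particular $\mathrm{Pf}_I(A)\neq0$. Equivalently, if $I=\{i_1<\cdots<i_{|I|}\}$ and $[n]\setminus I=\{j_1<\cdots<j_{n-|I|}\}$, this is the sign of the permutation $i_1,\dots,i_{|I|},j_1,\dots,j_{n-|I|}$ in one-line notation.
   Context: For a skew-symmetric $2m\times 2m$ matrix $B=(b_{ij})$, $\mathrm{Pf}(B)=\frac{1}{2^m m!}\sum_{\sigma\in S_{2m}}\operatorname{sgn}(\sigma)\prod_{i=1}^m b_{\sigma(2i-1),\sigma(2i)}$. For $A\in\mathcal{SS}_n$ and $I\subseteq[n]$ of even size, $\mathrm{Pf}_I(A)$ is the Pfaffian of the principal submatrix of $A$ with rows and columns $I$ (in increasing order), with $\mathrm{Pf}_\emptyset(A)=1$. Totally positive matrices: fix $n\ge2$, $N=\binom n2$; let $x_i(t)=\mathrm{Id}_{2n}+tE_{i,i+1}-tE_{n+i+1,n+i}$ ($1\le i\le n-1$), $x_n(t)=\mathrm{Id}_{2n}+tE_{n-1,2n}-tE_{n,2n-1}$ ($E_{a,b}$ matrix units); let $(i_1,\dots,i_N)$ be the concatenation, for $m=1,\dots,\lfloor n/2\rfloor$, of the blocks ''$n$'', ''$n-2,n-3,\dots,2m-1$'', ''$n-1,n-2,\dots,2m$'' (empty runs if start $<$ end).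 For $t\in\mathbb R^N$ let $[U(t)\mid R(t)]$ be the first $n$ rows of $x_{i_1}(t_1)\cdots x_{i_N}(t_N)$ ($U(t)$ the upper unitriangular left block) and $A(t)=U(t)^{-1}R(t)$. Then $\mathcal{SS}_n^{>0}=\{A(t):t\in\mathbb R^N_{>0}\}$. *)

(* Defs.v *)
From HB Require Import structures.
From mathcomp Require Import all_boot all_order all_algebra all_fingroup.
Set Implicit Arguments. Unset Strict Implicit. Unset Printing Implicit Defensive.
Import Order.TTheory GRing.Theory Num.Theory.
Local Open Scope ring_scope.

Section Defs.
Variable R : realFieldType.

Lemma pidx_lt (k : nat) (i : 'I_(k./2)) (b : bool) : (i.*2 + b < k)%N.
Proof.
have hi := ltn_ord i.
have h1 : (i.*2 + b < (k./2).*2)%N.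
  by case: b; rewrite ?addn0 ?addn1 -?doubleS ?ltn_double ?leq_double //; rewrite ltn_double.
apply: (leq_trans h1).
by rewrite -{2}(odd_double_half k) leq_addl.
Qed.

Definition pidx (k : nat) (i : 'I_(k./2)) (b : bool) : 'I_k := Ordinal (pidx_lt i b).

(* Pfaffian of a k x k matrix, k = 2m (the paper's formula; only used for even k):
   Pf(B) = 1/(2^m m!) * sum_{s in S_{2m}} sgn(s) prod_{i=1}^m b_{s(2i-1), s(2i)} *)
Definition pfaffian (k : nat) (B : 'M[R]_k) : R :=
  (2 ^+ (k./2) * (k./2)`!%:R)^-1 *
  \sum_(s : 'S_k) (-1) ^+ s * \prod_(i < k./2) B (s (pidx i false)) (s (pidx i true)).

Definition principal_submx (n : nat) (A : 'M[R]_n) (I : {set 'I_n}) : 'M[R]_#|I| :=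
  \matrix_(i, j) A (enum_val i) (enum_val j).

(* Pf_I(A); element i : 'I_n stands for i+1 in [n] *)
Definition pfI (n : nat) (A : 'M[R]_n) (I : {set 'I_n}) : R :=
  pfaffian (principal_submx A I).

Definition Eunit (n a b : nat) : 'M[R]_(n + n) :=
  \matrix_(r, c) ((r.+1 == a) && (c.+1 == b))%:R.

Definition xgen (n i : nat) (t : R) : 'M[R]_(n + n) :=
  if i == n then 1%:M + t *: Eunit n n.-1 (n + n) - t *: Eunit n n (n + n).-1
  else 1%:M + t *: Eunit n i i.+1 - t *: Eunit n (n + i).+1 (n + i).

Definition decrun (a b : nat) : seq nat :=
  if (a < b)%N then [::] else rev (iota b (a - b).+1).

Definition tp_word (n : nat) : seq nat :=
  flatten [seq [:: n] ++ decrun (n - 2) (m.*2 - 1) ++ decrun (n - 1) m.*2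
          | m <- iota 1 n./2].

Definition tp_prod (n : nat) (t : 'rV[R]_('C(n, 2))) : 'M[R]_(n + n) :=
  \big[@mulmx R _ _ _ / 1%:M]_(k < 'C(n, 2)) xgen n (nth 0%N (tp_word n) k) (t 0 k).

Definition Aparam (n : nat) (t : 'rV[R]_('C(n, 2))) : 'M[R]_n :=
  let top := usubmx (tp_prod t) : 'M[R]_(n, n + n) in
  invmx (lsubmx top) *m rsubmx top.

Definition SSpos (n : nat) (A : 'M[R]_n) : Prop :=
  exists t : 'rV[R]_('C(n, 2)), (forall k, 0 < t 0 k) /\ A = Aparam t.

End Defs.

(* Main.v *)
Require Import Defs.
From HB Require Import structures.
From mathcomp Require Import all_boot all_order all_algebra all_fingroup.
From mathcomp Require Import zify ring lra.
Import Order.TTheory GRing.Theory Num.Theory.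
Set Implicit Arguments. Unset Strict Implicit. Unset Printing Implicit Defensive.
Local Open Scope ring_scope.

(** Right multiplication of the product by x_i(t) changes A into
    (1 - t E_{i,i+1}) A (1 - t E_{i,i+1})^T for i < n, and adds
    t (E_{n-1,n} - E_{n,n-1}) to A for i = n. Put B_{ab} = - (-1)^{a+b} A_{ab}:
    then the congruences are by 1 + t E_{i,i+1}, so every step acts positively,
    Pf_I(B) becoming Pf_I(B) + t Pf_{I - i + (i+1)}(B) or
    Pf_I(B) + t Pf_{I - {n-1,n}}(B) when the new index set makes sense, and
    staying unchanged otherwise. Starting from B = 0, where only Pf_{set0} = 1 is
    nonzero, Pf_I(B) is therefore positive as soon as I can be brought to the
    empty set by reading the word backwards, optionally moving i to i+1 at a
    letter i < n and removing {n-1,n} at a letter n. Read backwards, block m can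
    carry the two largest elements of I to n and n-1 and remove them; inductively,
    after blocks m, ..., 1 read in this way every even I all of whose elements but
    the largest are at most 2m has been emptied. *)

(** * Pfaffians *)

Section Pfaffian.
Variable R : realFieldType.

Definition pfterm k (M : 'M[R]_k) (s : 'S_k) : R :=
  (-1) ^+ s * \prod_(i < k./2) M (s (pidx i false)) (s (pidx i true)).

Lemma pfaffianE k (M : 'M[R]_k) :
  pfaffian M = (2 ^+ (k./2) * (k./2)`!%:R)^-1 * \sum_s pfterm M s.
Proof. by []. Qed.

(** Composing [s] with the transposition of p and q keeps the product and reverses the sign, so the
    sum is its own opposite. *)
Lemma pfaffian_dup k (M : 'M[R]_k) (p q : 'I_k) : p != q ->
  (forall x y, M (tperm p q x) (tperm p q y) = M x y) -> pfaffian M = 0.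
Proof.
move=> pq Mpq; rewrite pfaffianE; set S := \sum_s _.
suff SN : S = - S by have -> : S = 0; [lra | rewrite mulr0].
rewrite {1}/S (reindex_inj (mulIg (tperm p q))) -sumrN; apply: eq_bigr => s _.
rewrite /pfterm odd_permM odd_tperm pq addbT signrN mulNr.
by congr (- (_ * _)); apply: eq_bigr => i _; rewrite !permM Mpq.
Qed.

Lemma val_pidx k (i : 'I_k./2) b : val (@pidx k i b) = (i.*2 + b)%N.
Proof. by []. Qed.

Lemma pidx_surj k (q : 'I_k) : ~~ odd k -> exists i b, q = @pidx k i b.
Proof.
move=> ek; have lt_q : (q./2 < k./2)%N by have := ltn_ord q; lia.
by exists (Ordinal lt_q), (odd q); apply: val_inj => /=; lia.
Qed.

Lemma pidx_inj k (i j : 'I_k./2) b c : @pidx k i b = pidx j c -> i = j /\ b = c.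
Proof.
move=> /(congr1 val) /= e; split; first by apply: val_inj => /=; lia.
by case: b c e => -[] //=; lia.
Qed.

(** Every permutation term has exactly one factor involving the index p, hence is linear in row and
    column p taken together. *)
Lemma pfaffian_linear k (p : 'I_k) (L M N : 'M[R]_k) (t : R) : ~~ odd k ->
  (forall x y, x != p -> y != p -> L x y = M x y /\ N x y = M x y) ->
  (forall x, x != p -> L x p = M x p + t * N x p /\ L p x = M p x + t * N p x) ->
  pfaffian L = pfaffian M + t * pfaffian N.
Proof.
move=> ek off on; rewrite !pfaffianE mulrCA -mulrDr; congr (_ * _).
rewrite mulr_sumr -big_split /=; apply: eq_bigr => s _; rewrite /pfterm mulrCA -mulrDr.
congr (_ * _); have [i [b e]] := pidx_surj (perm_inv s p) ek.
have sp : s (pidx i b) = p by rewrite -e permKV.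
have s_neq j c : (j != i) || (c != b) -> s (pidx j c) != p.
  by apply: contraTneq; rewrite -sp => /perm_inj/pidx_inj[-> ->]; rewrite !eqxx.
have D1 (G : 'I_k./2 -> R) : \prod_l G l = G i * \prod_(l | l != i) G l.
  exact: bigD1.
rewrite !D1.
have [-> ->] : \prod_(j < k./2 | j != i) L (s (pidx j false)) (s (pidx j true)) =
               \prod_(j < k./2 | j != i) M (s (pidx j false)) (s (pidx j true)) /\
               \prod_(j < k./2 | j != i) N (s (pidx j false)) (s (pidx j true)) =
               \prod_(j < k./2 | j != i) M (s (pidx j false)) (s (pidx j true)).
  by split; apply: eq_bigr => j ji; case: (off (s (pidx j false)) (s (pidx j true)));
    rewrite ?s_neq ?ji.
rewrite mulrA -mulrDl; congr (_ * _).
case: b sp s_neq {e} => sp s_neq; rewrite sp.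
  by case: (on (s (pidx i false))) => [|->]; rewrite ?s_neq ?orbT.
by case: (on (s (pidx i true))) => [|_ ->]; rewrite ?s_neq ?orbT.
Qed.

(** Exchanging two whole pairs is an even permutation and only reorders the factors. *)
Lemma pfterm_swap k (M : 'M[R]_k) (i j : 'I_k./2) s :
  pfterm M (tperm (pidx i false) (pidx j false) * (tperm (pidx i true) (pidx j true) * s))%g
  = pfterm M s.
Proof.
set a := tperm (pidx i false) _; set c := tperm (pidx i true) _.
have pE (l : 'I_k./2) b : c (a (pidx l b)) = pidx (tperm i j l) b.
  have pidxE (x y : 'I_k./2) u v : (@pidx k x u == pidx y v) = (x == y) && (u == v).
    by apply/eqP/andP => [/pidx_inj[-> ->]|[/eqP-> /eqP->]].
  have aT x : a (pidx x true) = pidx x true by rewrite tpermD // pidxE andbF.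
  have cF x : c (pidx x false) = pidx x false by rewrite tpermD // pidxE andbF.
  have neq x u v : x != l -> pidx x u != pidx l v :> 'I_k.
    by apply: contraNneq => /pidx_inj[->].
  have aF : a (pidx l false) = pidx (tperm i j l) false.
    rewrite /a; case: (tpermP i j l) => [->|->|/eqP li /eqP lj]; rewrite ?tpermL ?tpermR //.
    by rewrite tpermD // neq // eq_sym.
  have cT : c (pidx l true) = pidx (tperm i j l) true.
    rewrite /c; case: (tpermP i j l) => [->|->|/eqP li /eqP lj]; rewrite ?tpermL ?tpermR //.
    by rewrite tpermD // neq // eq_sym.
  by case: b; rewrite ?aT ?aF ?cT ?cF.
rewrite /pfterm !odd_permM !odd_tperm.
have -> : (pidx i true != pidx j true) = (pidx i false != pidx j false).
  by congr (~~ _); apply/eqP/eqP => /pidx_inj[->].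
rewrite addbA addbb; congr (_ * _).
rewrite [RHS](reindex_inj (@perm_inj _ (tperm i j))); apply: eq_bigr => l _.
by rewrite !permM !pE.
Qed.

(** The sign of the permutation and, by skew symmetry, the factor of pair i both change sign. *)
Lemma pfterm_flip k (M : 'M[R]_k) (i : 'I_k./2) s : (forall x y, M x y = - M y x) ->
  pfterm M (tperm (pidx i false) (pidx i true) * s)%g = pfterm M s.
Proof.
move=> skew; rewrite /pfterm odd_permM odd_tperm.
have -> : pidx i false != pidx i true by apply/eqP => /pidx_inj[].
have D1 (G : 'I_k./2 -> R) : \prod_l G l = G i * \prod_(l | l != i) G l.
  exact: bigD1.
rewrite signrN !D1 !permM tpermL tpermR.
rewrite [M (s (pidx i true)) _]skew !mulNr mulrN opprK.
congr (_ * (_ * _)); apply: eq_bigr => j ji; rewrite !permM.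
by rewrite !tpermD //; apply: contraNneq ji => /pidx_inj[->].
Qed.

Lemma lift_perm_surj k (i j : 'I_k.+1) (s : 'S_k.+1) :
  s i = j -> exists u, s = lift_perm i j u.
Proof.
move=> sij; pose f x := odflt x (unlift j (s (lift i x))).
have fE x : lift j (f x) = s (lift i x).
  have : j != s (lift i x) by rewrite -sij (inj_eq perm_inj) neq_lift.
  by rewrite /f => /unlift_some[y -> ->].
have f_inj : injective f.
  by move=> x y /(congr1 (lift j)); rewrite !fE => /perm_inj/lift_inj.
exists (perm f_inj); apply/permP => x; case: (unliftP i x) => [y|] ->.
  by rewrite lift_perm_lift permE fE.
by rewrite lift_perm_id.
Qed.

Lemma lift_perm_inj k (i j : 'I_k.+1) : injective (lift_perm i j).
Proof.
move=> u v /permP uv; apply/permP => x.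
by apply: (@lift_inj _ j); rewrite -!(lift_perm_lift i) uv.
Qed.

Lemma sum_lift_perm k (i j : 'I_k.+1) (F : 'S_k.+1 -> R) :
  \sum_(s : 'S_k.+1 | s i == j) F s = \sum_s F (lift_perm i j s).
Proof.
rewrite (eq_bigl (mem (lift_perm i j @: setT))) => [|s /=].
  by rewrite big_imset /= => [|u v _ _ /lift_perm_inj//]; apply: eq_bigl => s; rewrite inE.
apply/eqP/imsetP => [/lift_perm_surj[u ->]|[u _ ->]]; first by exists u.
by rewrite lift_perm_id.
Qed.

(** Expansion along the last column, whose only nonzero entry is the 1 just above the diagonal. By
    symmetry [ord_max] may be put in the last position; its partner must then be k, and both are
    deleted. *)
Lemma pfaffian_pair k (N : 'M[R]_k.+2) : ~~ odd k -> (forall x y, N x y = - N y x) ->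
  (forall x, N x ord_max = (x == k :> nat)%:R) ->
  pfaffian N = pfaffian (\matrix_(x < k, y < k)
    N (lift ord_max (lift ord_max x)) (lift ord_max (lift ord_max y))).
Proof.
move=> ek skew N_max; pose m : 'I_(k.+2)./2 := ord_max.
have mE : m = k./2 :> nat by [].
have top1 : pidx m true = ord_max by apply: val_inj; rewrite val_pidx mE [RHS]/=; lia.
have top0 : pidx m false = lift ord_max (ord_max : 'I_k.+1).
  by apply/val_inj/(etrans _ (esym (lift_max _))); rewrite val_pidx mE /=; lia.
(* All positions of [ord_max] contribute equally: flip its pair if it comes first there, then
   exchange that pair with the last one. *)
have orbit q : \sum_(s : 'S_k.+2 | s q == ord_max) pfterm N s =
               \sum_(s : 'S_k.+2 | s ord_max == ord_max) pfterm N s.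
  have [|i [b ->]] := @pidx_surj k.+2 q; first by rewrite /= negbK.
  have to_true : \sum_(s : 'S_k.+2 | s (pidx i true) == ord_max) pfterm N s =
               \sum_(s : 'S_k.+2 | s ord_max == ord_max) pfterm N s.
    rewrite (reindex_inj (mulgI (tperm (pidx i false) (pidx m false) *
                                 tperm (pidx i true) (pidx m true))%g)) /=.
    apply: eq_big => s; last by rewrite -mulgA pfterm_swap.
    rewrite !permM (@tpermD _ (pidx i false)) ?tpermL ?top1 //; 
    by apply/eqP => /pidx_inj[].
  case: b => //; rewrite -to_true.
  rewrite (reindex_inj (mulgI (tperm (pidx i false) (pidx i true)))) /=.
  by apply: eq_big => s; rewrite ?pfterm_flip // permM tpermL.
rewrite !pfaffianE (_ : (k.+2)./2 = (k./2).+1) // factS natrM exprS.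
rewrite (partition_big (fun s : 'S_k.+2 => (s^-1)%g ord_max) predT) //=.
rewrite (eq_bigr (fun _ => \sum_(s : 'S_k.+2 | s ord_max == ord_max) pfterm N s)); last first.
  move=> q _; rewrite -(orbit q); apply: eq_bigl => s.
  by rewrite eq_sym -(inj_eq (@perm_inj _ s)) permKV.
rewrite sumr_const card_ord sum_lift_perm.
(* A term survives only if the partner of [ord_max] is the index k. *)
rewrite (bigID (fun s : 'S_k.+1 => s ord_max == ord_max)) /=.
rewrite [X in _ + X]big1 ?addr0; last first.
  move=> s s_max; rewrite /pfterm (bigD1 m) //= top0 top1 lift_perm_id lift_perm_lift.
  rewrite N_max /=.
  have -> : (bump k.+1 (s ord_max) == k) = false.
    rewrite /bump leqNgt ltn_ord; apply: contraNF s_max => /eqP s_k.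
    by apply/eqP/val_inj.
  by rewrite mul0r mulr0.
rewrite sum_lift_perm.
set S := \sum_s _; set S' := \sum_s _.
have -> : S = S'.
  apply: eq_bigr => s _; rewrite /pfterm !odd_lift_perm; congr (_ * _).
    by rewrite !addbb.
  rewrite big_ord_recr -/m /= top0 top1 lift_perm_id !lift_perm_lift lift_perm_id N_max /=.
  rewrite /bump ltnn eqxx mulr1; apply: eq_bigr => i _; rewrite mxE.
  have E (j : 'I_k./2) b : @pidx k.+2 (widen_ord (leqnSn k./2) j) b =
      lift ord_max (lift ord_max (pidx j b)).
    exact/val_inj/(etrans _ (esym (etrans (lift_max _) (lift_max _)))).
  by rewrite !E !lift_perm_lift.
(* The k + 2 equal contributions cancel against the ratio of the two normalizing constants. *)
have k0 : (k.+2%:R : R) = 2 * (k./2).+1%:R by rewrite -natrM; congr (_%:R); lia.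
have scale (e m' f : R) : e != 0 -> m' != 0 -> f != 0 ->
    (2 * e * (m' * f))^-1 * (2 * m' * S') = (e * f)^-1 * S'.
  by move=> e0 m0 f0; field; rewrite f0 m0 e0.
by rewrite -[S' *+ _]mulr_natl k0; apply: scale;
  rewrite ?expf_neq0 ?pnatr_eq0 // -lt0n fact_gt0.
Qed.

End Pfaffian.

(** * Subsets of [n] as increasing maps *)

Definition update (h : nat -> nat) (p v x : nat) : nat := if x == p then v else h x.

(** Values of h from k on are irrelevant, so removing the two largest elements just lowers k by
    2. *)
Definition increasing_in (n k : nat) (h : nat -> nat) : Prop :=
  (forall x, (x < k)%N -> (0 < h x <= n)%N) /\
  (forall x y, (x < y < k)%N -> (h x < h y)%N).

Lemma increasing_in_neq n k h x y : increasing_in n k h ->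
  (x < k)%N -> (y < k)%N -> x != y -> h x != h y.
Proof.
move=> [_ h_inc] xk yk; case: ltngtP => // xy _.
  by have := h_inc x y; lia.
by have := h_inc y x; lia.
Qed.

Lemma increasing_in_update n k h p v : increasing_in n k h ->
  (h p <= v <= n)%N -> (forall y, (p < y < k)%N -> (v < h y)%N) ->
  increasing_in n k (update h p v).
Proof.
move=> [h_in h_inc] hv v_lt; split => [x xk|x y xyk]; rewrite /update.
  by case: eqP => [xp|_]; [have := h_in x xk; rewrite xp; lia | exact: h_in].
have := h_inc x y xyk; case: eqP => [xp|_]; case: eqP => [yp|_]; try by lia.
- by move=> _; apply: v_lt; lia.
- by subst y; lia.
Qed.

(** * Positivity of the elementary steps *)

Section Steps.
Variable R : realFieldType.
Implicit Types B : nat -> nat -> R.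

Definition pff k B (h : nat -> nat) : R := pfaffian (\matrix_(x < k, y < k) B (h x) (h y)).

Definition skew B := forall a b, B a b = - B b a.

Definition shear_row i t B a b : R := B a b + (a == i)%:R * t * B i.+1 b.

Definition shear i t B a b : R :=
  shear_row i t B a b + (b == i)%:R * t * shear_row i t B a i.+1.

Definition add_wedge n t B a b : R :=
  B a b + t * ((a == n.-1) && (b == n))%:R - t * ((a == n) && (b == n.-1))%:R.

(* One letter of the word, acting on B_{ab} = - (-1)^{a+b} A_{ab} with 1-based indices. *)
Definition step n i t B := if i == n then add_wedge n t B else shear i t B.

Lemma skew_diag B a : skew B -> B a a = 0.
Proof. by move/(_ a a); lra. Qed.

Lemma step_skew n i t B : skew B -> skew (step n i t B).
Proof.
move=> skB a b; rewrite /step; case: eqP => _.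
  by rewrite /add_wedge (skB a b) [(b == n.-1) && _]andbC [(b == n) && _]andbC; ring.
have d := skew_diag i.+1 skB.
rewrite /shear /shear_row (skB a b) (skB a i.+1) (skB i.+1 b) d; ring.
Qed.

Lemma eq_pff k B B' h h' :
  (forall x y, (x < k)%N -> (y < k)%N -> B (h x) (h y) = B' (h' x) (h' y)) ->
  pff k B h = pff k B' h'.
Proof. by move=> e; congr pfaffian; apply/matrixP => x y; rewrite !mxE e. Qed.

Lemma pff_dup k B h p q : (p < k)%N -> (q < k)%N -> p != q -> h p = h q -> pff k B h = 0.
Proof.
move=> pk qk pq hpq; apply: (@pfaffian_dup _ _ _ (Ordinal pk) (Ordinal qk)) => // x y.
have E z : h (tperm (Ordinal pk) (Ordinal qk) z) = h z by case: tpermP => [->|->|].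
by rewrite !mxE !E.
Qed.

(** On these indices only row and column p change, by t times those of index h p + 1, so linearity
    applies. *)
Lemma pff_shear k B h p t : ~~ odd k -> skew B -> (p < k)%N ->
  (forall x, (x < k)%N -> x != p -> h x != h p) ->
  pff k (shear (h p) t B) h = pff k B h + t * pff k B (update h p (h p).+1).
Proof.
move=> ek skB pk h_neq; apply: (@pfaffian_linear _ _ (Ordinal pk)) => // [x y|x] xp.
  have {}xp : (x : nat) != p by [].
  move=> yp; have {}yp : (y : nat) != p by [].
  rewrite !mxE /shear /shear_row /update (negPf xp) (negPf yp).
  rewrite !(negPf (h_neq _ _ _)) //.
  by rewrite !mul0r !addr0.
have {}xp : (x : nat) != p by [].
have d := skew_diag (h p).+1 skB.
have hx : (h x == h p) = false by exact/negbTE/h_neq.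
rewrite !mxE /shear /shear_row /update /= hx (negPf xp) !eqxx /=.
by split; ring.
Qed.

Lemma pff_step_id n i t k B h :
  (forall x, (x < k)%N -> i != n -> h x != i) ->
  (forall x y, (x < k)%N -> (y < k)%N -> i = n -> h x = n.-1 -> h y <> n) ->
  pff k (step n i t B) h = pff k B h.
Proof.
move=> h_neq h_pair; apply: eq_pff => x y xk yk; rewrite /step.
case: eqP => [i_n|/eqP i_n].
  rewrite /add_wedge.
  have -> : (h x == n.-1) && (h y == n) = false.
    by apply/negbTE/negP => /andP[/eqP + /eqP]; apply: h_pair.
  have -> : (h x == n) && (h y == n.-1) = false.
    by apply/negbTE/negP => /andP[/eqP + /eqP] => /[swap]; apply: h_pair.
  by rewrite !mulr0 subr0 addr0.
rewrite /shear /shear_row !(negPf (h_neq _ _ _)) //.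
by rewrite !mul0r !addr0.
Qed.

(** Linearity in the last row and column, where the added part is E_{n-1,n} - E_{n,n-1};
    [pfaffian_pair] evaluates its Pfaffian. *)
Lemma pff_add_wedge n k t B h : ~~ odd k -> skew B -> increasing_in n k.+2 h ->
  h k = n.-1 -> h k.+1 = n ->
  pff k.+2 (add_wedge n t B) h = pff k.+2 B h + t * pff k B h.
Proof.
move=> ek skB [h_in h_inc] hk hk1.
have n_gt0 : (0 < n.-1)%N by rewrite -hk; case/andP: (h_in k (ltnW (ltnSn _))).
have h_eq1 (x : 'I_k.+2) : (h x == n) = (x == ord_max).
  apply/eqP/eqP => [hx|->//]; apply: val_inj => /=.
  by have := h_inc x k.+1; have := ltn_ord x; lia.
have h_eq0 (x : 'I_k.+2) : (h x == n.-1) = (x == k :> nat).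
  apply/eqP/eqP => [hx|->//].
  have := h_inc x k; have := h_inc k x; have := ltn_ord x; lia.
pose N : 'M[R]_k.+2 := \matrix_(x, y) if y == ord_max then (x == k :> nat)%:R
  else if x == ord_max then - (y == k :> nat)%:R else B (h x) (h y).
have k_max : ((ord_max : 'I_k.+2) == k :> nat) = false by apply/eqP => /=; lia.
rewrite /pff (@pfaffian_linear _ _ ord_max _ (\matrix_(x, y) B (h x) (h y)) N t) //.
- congr (_ + _ * _); rewrite pfaffian_pair //.
  + congr pfaffian; apply/matrixP => x y; rewrite !mxE.
    by rewrite !(eq_sym _ ord_max) !(negPf (neq_lift _ _)) !lift_max.
  + move=> x y; rewrite !mxE; case: (y =P ord_max) => [ey|_]; case: (x =P ord_max) => [ex|_];
      by rewrite ?ex ?ey ?k_max ?oppr0 ?opprK.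
  + by move=> x; rewrite mxE eqxx.
- by rewrite /= negbK.
- move=> x y xm ym; rewrite !mxE /add_wedge !h_eq1 (negPf xm) (negPf ym) andbF /=.
  by rewrite !mulr0 addr0 subr0.
- move=> x xm; rewrite !mxE /add_wedge !h_eq1 !h_eq0 (negPf xm) !eqxx k_max ?andbT ?andbF /=.
  by split; ring.
Qed.

(** The head of the list is the letter applied last, so the list is the word read backwards. *)
Fixpoint run n (l : seq (nat * R)) : nat -> nat -> R :=
  if l is (i, t) :: l' then step n i t (run n l') else fun _ _ => 0.

Lemma run_skew n l : skew (run n l).
Proof.
elim: l => [|[i t] l IH] /=; last exact: step_skew.
by move=> a b /=; rewrite oppr0.
Qed.

Lemma pff0 B h : pff 0 B h = 1.
Proof.
rewrite /pff pfaffianE (bigD1 1%g) //= big1 => [|s].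
  by rewrite /pfterm odd_perm1 big_ord0 expr0 fact0 !mulr1 addr0 invr1 mulr1.
by case/eqP; apply/permP => -[].
Qed.

(** A step adds nothing, or t times another Pfaffian of [run n l], which is zero or covered by the
    nonnegativity assumption. *)
Lemma pff_run_step_ge n l i t k h : ~~ odd k -> increasing_in n k h -> 0 <= t ->
  (forall k h, ~~ odd k -> increasing_in n k h -> 0 <= pff k (run n l) h) ->
  pff k (run n l) h <= pff k (step n i t (run n l)) h.
Proof.
move=> ek h_inc t0 nn; have skB := run_skew n l.
have [i_n|i_n] := eqVneq i n.
  have [/hasP[x xk /hasP[y yk /andP[/eqP hx /eqP hy]]]|/hasPn h_pair] :=
      boolP (has (fun x => has (fun y => (h x == n.-1) && (h y == n)) (iota 0 k)) (iota 0 k)).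
    rewrite !mem_iota /= !add0n in xk yk.
    have [h_in h_lt] := h_inc.
    have n0 := h_in x xk.
    (* The values n - 1 and n can only sit in the last two positions. *)
    have xy : (x < y)%N.
      by have := h_lt y x; have := h_in y yk; case: (ltngtP x y) => // [|e]; [|subst y]; lia.
    have yx : y = x.+1.
      by have := h_lt x x.+1; have := h_lt x.+1 y; lia.
    have ky : k = y.+1.
      by have := h_lt y y.+1; have := h_in y.+1; lia.
    subst k y; rewrite /step i_n eqxx pff_add_wedge //; last by rewrite /= negbK in ek.
    rewrite lerDl mulr_ge0 // nn //; first by rewrite /= negbK in ek.
    by split => [z zk|z w zw]; [apply: h_in; lia | apply: h_lt; lia].
  rewrite pff_step_id // => [x _|x y xk yk _ hx hy]; first by rewrite i_n eqxx.
  have := h_pair x; rewrite mem_iota add0n => /(_ xk)/hasPn/(_ y).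
  by rewrite mem_iota add0n => /(_ yk); rewrite hx hy !eqxx.
have [/hasP[p pk /eqP hp]|/hasPn h_neq] := boolP (has (fun x => h x == i) (iota 0 k)).
  rewrite mem_iota add0n /= in pk.
  rewrite /step (negPf i_n) -hp pff_shear //; last first.
    by move=> x xk xp; apply: increasing_in_neq h_inc _ _ _.
  rewrite lerDl mulr_ge0 //.
  have [h_in h_lt] := h_inc.
  (* If h p + 1 is already in the set, the shifted list repeats an index and its Pfaffian
     vanishes. *)
  have [/andP[pk1 /eqP hp1]|no_next] := boolP ((p.+1 < k)%N && (h p.+1 == (h p).+1)).
    rewrite (@pff_dup _ _ _ p p.+1) ?neq_ltn ?ltnSn //.
    by rewrite /update eqxx hp1 gtn_eqF.
  apply: nn => //; apply: increasing_in_update => //; first by have := h_in p pk; lia.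
  move=> y py; have := h_lt p p.+1; have := h_lt p.+1 y.
  by have [->|] := eqVneq y p.+1; move: no_next; lia.
rewrite pff_step_id // => [x xk _|x y _ _ /eqP]; last by rewrite (negPf i_n).
by apply: h_neq; rewrite mem_iota.
Qed.

Lemma pff_run_ge0 n l : all (fun u => 0 < u.2) l ->
  forall k h, ~~ odd k -> increasing_in n k h -> 0 <= pff k (run n l) h.
Proof.
elim: l => [|[i t] l IH] /= => [_ k h ek _|/andP[t0 /IH nn] k h ek h_inc]; last first.
  by apply: le_trans (nn k h ek h_inc) _; apply: pff_run_step_ge => //; exact: ltW.
case: k ek => [|[//|k]] ek; first by rewrite pff0.
rewrite /pff pfaffianE big1 ?mulr0 // => s _.
by rewrite /pfterm (bigD1 ord0) //= mxE mul0r mulr0.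
Qed.

End Steps.

(* [reach n w k h]: reading the letters of w from left to right empties the set
   {h 0 < ... < h (k - 1)}; w is the reverse of a prefix of the reduced word. *)
Inductive reach (n : nat) : seq nat -> nat -> (nat -> nat) -> Prop :=
| reach_nil h : reach n [::] 0 h
| reach_skip i w k h : reach n w k h -> reach n (i :: w) k h
| reach_move i w k h p : i != n -> (p < k)%N -> h p = i ->
    increasing_in n k (update h p i.+1) -> reach n w k (update h p i.+1) ->
    reach n (i :: w) k h
| reach_pair w k h : h k = n.-1 -> h k.+1 = n -> reach n w k h -> reach n (n :: w) k.+2 h.

(** Induction on the derivation: a skipped letter never decreases the Pfaffian, and a used letter
    adds t times a positive Pfaffian to a nonnegative one. *)
Lemma pff_run_gt0 (R : realFieldType) n (l : seq (nat * R)) k h :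
  all (fun u => 0 < u.2) l -> ~~ odd k -> increasing_in n k h ->
  reach n (unzip1 l) k h -> 0 < pff k (run n l) h.
Proof.
move=> l_pos ek h_inc; move E : (unzip1 l) => w r.
elim: r l l_pos E ek h_inc =>
    {w k h} [h|i w k h _ IH|i w k h p i_n pk hp u_inc _ IH|w k h hk hk1 _ IH]
  [|[i' t] l] //= => [_ _ _ _|/andP[t0 l_pos] [-> El] ek h_inc|/andP[t0 l_pos] [-> El] ek h_inc
   |/andP[t0 l_pos] [-> El] ek h_inc].
- by rewrite pff0.
- apply: lt_le_trans (IH l l_pos El ek h_inc) _.
  by apply: pff_run_step_ge => //; [exact: ltW | exact: pff_run_ge0].
- have nn := pff_run_ge0 l_pos ek h_inc.
  rewrite /step (negPf i_n) -hp pff_shear //; last first.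
  + by move=> x xk xp; apply: increasing_in_neq h_inc _ _ _.
  + exact: run_skew.
  by rewrite ltr_wpDl // mulr_gt0 // hp IH.
- have ek2 : ~~ odd k.+2 by [].
  have nn := pff_run_ge0 l_pos ek2 h_inc; rewrite negbK in ek.
  rewrite /step eqxx pff_add_wedge //; last exact: run_skew.
  rewrite ltr_wpDl // mulr_gt0 // IH //; case: h_inc => h_in h_lt.
  by split => [x xk|x y xyk]; [apply: h_in; lia | apply: h_lt; lia].
Qed.

(** * The reduced word *)

Local Close Scope ring_scope.

Lemma reach_cat n u w k h : reach n w k h -> reach n (u ++ w) k h.
Proof. by move=> r; elim: u => //= i u; apply: reach_skip. Qed.

(** The entry at p waits until the run reaches its value, then climbs with each letter up to b + c,
    staying below the later entries. The resulting map h' is known only through its properties. *)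
Lemma reach_iota n w k h p b c : increasing_in n k h -> (p < k)%N ->
  (b <= h p <= b + c)%N -> (b + c <= n)%N ->
  (forall y, (p < y < k)%N -> (b + c < h y)%N) ->
  (forall h', increasing_in n k h' -> h' p = (b + c)%N ->
     (forall x, x != p -> h' x = h x) -> reach n w k h') ->
  reach n (iota b c ++ w) k h.
Proof.
move=> h_inc pk + bcn; elim: c b h h_inc bcn => [|c IH] b h h_inc bcn hp above r /=.
  by apply: r => //; lia.
have [hpb|hpb] := eqVneq (h p) b.
  have u_inc : increasing_in n k (update h p b.+1).
    by apply: increasing_in_update => // [|y py]; [lia | have := above y py; lia].
  apply: (reach_move _ pk hpb u_inc); first by lia.
  apply: IH => // [||y py|h' h'_inc h'p h'E].
  - by lia.
  - by rewrite /update eqxx; lia.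
  - by rewrite /update; case: eqP; have := above y py; lia.
  - apply: r => // [|x xp]; first by lia.
    by rewrite h'E // /update (negPf xp).
apply: reach_skip; apply: IH => // [||y py|h' h'_inc h'p h'E].
- by lia.
- by lia.
- by have := above y py; lia.
- by apply: r => //; lia.
Qed.

Definition tp_block (n m : nat) : seq nat :=
  [:: n] ++ decrun (n - 2) (m.*2 - 1) ++ decrun (n - 1) m.*2.

Lemma rev_decrun a b : (b <= a.+1)%N -> rev (decrun a b) = iota b (a.+1 - b).
Proof.
move=> ba; rewrite /decrun; case: ltnP => ab; last by rewrite revK subSn.
by have -> : (a.+1 - b = 0)%N by lia.
Qed.

(** Backwards, the runs are 2m, ..., n - 1 and 2m - 1, ..., n - 2, which can lift entries to n and n
    - 1 respectively. *)
Lemma rev_tp_block n m : (0 < m <= n./2)%N ->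
  rev (tp_block n m) = iota m.*2 (n - m.*2) ++ iota (m.*2 - 1) (n - m.*2) ++ [:: n].
Proof.
move=> mn; rewrite /tp_block !rev_cat !rev_decrun; [|lia|lia].
by rewrite -catA; congr (iota _ _ ++ iota _ _ ++ _); lia.
Qed.

(** The last condition bounds the second largest element, and is vacuous for the empty set. *)
Definition reach_upto n m w := forall k h, ~~ odd k -> increasing_in n k h ->
  (forall j, k = j.+2 -> (h j <= m.*2)%N) -> reach n w k h.

(* The top two entries slide to n and n - 1 along the two runs of the block, and are then
   removed by the letter n. *)
Lemma reach_upto_block n m w : (0 < m <= n./2)%N ->
  reach_upto n m.-1 w -> reach_upto n m (rev (tp_block n m) ++ w).
Proof.
move=> mn r k h ek h_inc h_le; rewrite rev_tp_block // -!catA.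
case: k ek h_inc h_le => [|[//|k]] ek h_inc h_le.
  by do 3![apply: reach_cat]; apply: r.
have {}h_le := h_le k erefl; have [h_in h_lt] := h_inc.
(* If the second largest element is at most 2(m - 1), the whole block is skipped. *)
have [hk|hk] := leqP (h k) m.-1.*2.
  by do 3![apply: reach_cat]; apply: r => // j [<-].
have k_in := h_in k; have k1_in := h_in k.+1; have k_lt := h_lt k k.+1.
(* Now h k is 2m - 1 or 2m, so h (k + 1) is at least 2m: each of the two entries is in the range of
   its run. *)
apply: (@reach_iota _ _ _ _ k.+1) => // [||y|h1 h1_inc h1k1 h1E]; try lia.
have h1k : h1 k = h k by rewrite h1E // ltn_eqF.
apply: (@reach_iota _ _ _ _ k) => // [||y yk|h2 h2_inc h2k h2E]; try lia.
  have -> : y = k.+1 by lia. by lia.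
have h2k1 : h2 k.+1 = h1 k.+1 by rewrite h2E // gtn_eqF.
apply: reach_pair; [lia | lia|].
have [h2_in h2_lt] := h2_inc.
apply: r; first by rewrite /= negbK in ek.
  by split => [x xk|x y xyk]; [apply: h2_in; lia | apply: h2_lt; lia].
(* The new second largest element is at most h k - 2, hence at most 2(m - 1). *)
move=> j kj; have -> : h2 j = h j by rewrite h2E ?h1E //; lia.
by have := h_lt j j.+1; have := h_lt j.+1 k; subst k; lia.
Qed.

(** After all blocks the bound on the second largest element is 2 floor(n/2) >= n - 1, which always
    holds. *)
Lemma reach_tp_word n k h : ~~ odd k -> increasing_in n k h ->
  reach n (rev (tp_word n)) k h.
Proof.
move=> ek h_inc.
have blocks m : (m <= n./2)%N -> reach_upto n m (rev (flatten [seq tp_block n i | i <- iota 1 m])).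
  elim: m => [_ [|[//|j]] h' _ [h_in h_lt] h_le /=|m IH mn].
  - exact: reach_nil.
  - by have := h_le j erefl; have := h_in j; lia.
  - rewrite -[m.+1]addn1 iotaD map_cat flatten_cat /= cats0 rev_cat add1n addn1.
    by apply: reach_upto_block => //; apply: IH; lia.
apply: (blocks _ (leqnn _)) => // j kj.
by have [h_in h_lt] := h_inc; have := h_lt j j.+1; have := h_in j.+1; subst k; lia.
Qed.

Lemma size_tp_word n : size (tp_word n) = 'C(n, 2).
Proof.
have decrunE a b : (b <= a.+1)%N -> size (decrun a b) = (a.+1 - b)%N.
  by move=> ba; rewrite -size_rev rev_decrun // size_iota.
(* Block i has 1 + 2(n - 2i) letters, which sum to m(2n - 1) - 2m^2. *)
have sz m : (m <= n./2)%N ->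
  (size (flatten [seq tp_block n i | i <- iota 1 m]) + m * m.*2 = m * (n.*2 - 1))%N.
  elim: m => [//|m IH] mn.
  have -> : iota 1 m.+1 = iota 1 m ++ [:: m.+1] by rewrite -[m.+1 in LHS]addn1 iotaD add1n.
  rewrite map_cat flatten_cat /= cats0 size_cat /= size_cat !decrunE; [|lia|lia].
  have := IH; nia.
have := sz n./2 (leqnn _); rewrite -/(tp_word n) bin2 => {sz decrunE} sz_n.
have n_half := odd_double_half n.
suff -> : (n * n.-1 = (size (tp_word n)).*2)%N by rewrite doubleK.
move: sz_n n_half; generalize (n./2) (size (tp_word n)) => h z.
case: (odd n) => /= sz_n n_half; subst n; last by case: h sz_n => [|h] /=; nia.
by rewrite add1n /= in sz_n *; nia.
Qed.

Local Open Scope ring_scope.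

(** * The parametrization *)

Section Link.
Variable R : realFieldType.
Implicit Types B : nat -> nat -> R.

Lemma prod_pidx k (g : 'I_k -> R) : ~~ odd k ->
  \prod_x g x = \prod_(i < k./2) (g (pidx i false) * g (pidx i true)).
Proof.
move=> ek; rewrite (reindex (fun u : 'I_k./2 * bool => pidx u.1 u.2)) /=.
  rewrite -(pair_bigA _ (fun i b => g (pidx i b))) /=.
  by apply: eq_bigr => i _; rewrite big_bool mulrC.
apply: onW_bij; apply: inj_card_bij => [[i b] [j c] /= /pidx_inj[-> ->]//|].
by rewrite card_prod card_bool !card_ord; lia.
Qed.

(** Each term uses every index once and has k/2 factors. *)
Lemma pfaffian_scale k (M : 'M[R]_k) (c : R) (e : 'I_k -> R) : ~~ odd k ->
  pfaffian (\matrix_(x, y) (c * (e x * e y * M x y))) =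
  c ^+ k./2 * \prod_x e x * pfaffian M.
Proof.
move=> ek; rewrite !pfaffianE mulrCA; congr (_ * _); rewrite mulr_sumr.
apply: eq_bigr => s _; rewrite /pfterm mulrCA; congr (_ * _).
have -> : c ^+ k./2 = \prod_(i < k./2) c by rewrite prodr_const card_ord.
rewrite (reindex_inj (@perm_inj _ s)) (prod_pidx (fun x => e (s x)) ek).
by rewrite -!big_split; apply: eq_bigr => i _; rewrite !mxE /= mulrA.
Qed.

(** Recovers A from B_{ab} = - (-1)^{a+b} A_{ab}; the ordinals a, b stand for a + 1, b + 1. *)
Definition signed_mx n B : 'M[R]_n := \matrix_(a, b) ((-1) ^+ (a + b).+1 * B a.+1 b.+1).

Definition superdiag n i : 'M[R]_n := \matrix_(a, b) ((a.+1 == i) && (b == i :> nat))%:R.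

Lemma mul_superdiag_mx n m i (lt_i : (i < n)%N) (M : 'M[R]_(n, m)) a b :
  (superdiag n i *m M) a b = (a.+1 == i)%:R * M (Ordinal lt_i) b.
Proof.
rewrite mxE (bigD1 (Ordinal lt_i)) //= big1 => [|x xi]; rewrite mxE /=.
  by rewrite eqxx andbT addr0.
rewrite (_ : (x == i :> nat) = false) ?andbF ?mul0r //.
by apply: contraNF xi => /eqP xi; apply/eqP/val_inj.
Qed.

Lemma mul_mx_superdiagT n m i (lt_i : (i < n)%N) (M : 'M[R]_(m, n)) a b :
  (M *m (superdiag n i)^T) a b = (b.+1 == i)%:R * M a (Ordinal lt_i).
Proof. by rewrite -[M]trmxK -trmx_mul mxE mul_superdiag_mx !mxE. Qed.

Lemma superdiag_sqr n i : (i < n)%N -> superdiag n i *m superdiag n i = 0.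
Proof.
move=> lt_i; apply/matrixP => a b; rewrite (mul_superdiag_mx lt_i) !mxE /=.
by rewrite (_ : (i.+1 == i) = false) ?mulr0 //; lia.
Qed.

(** Since i and i + 1 have opposite parity, the signs turn 1 + t E_{i,i+1} into 1 - t E_{i,i+1}. *)
Lemma signed_mx_shear n i t B : (i < n)%N ->
  signed_mx n (shear i t B) =
  (1%:M - t *: superdiag n i) *m signed_mx n B *m (1%:M - t *: (superdiag n i)^T).
Proof.
move=> lt_i; rewrite mulmxBr mulmx1 -scalemxAr mulmxBl mul1mx -scalemxAl.
apply/matrixP => a b; rewrite [RHS]mxE [X in _ = _ + X]mxE [X in _ = _ - X]mxE.
rewrite (mul_mx_superdiagT lt_i) ![(signed_mx n B - _) _ _]mxE.
rewrite ![(- (t *: (_ *m _))) _ _]mxE ![(t *: (_ *m _)) _ _]mxE !(mul_superdiag_mx lt_i).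
rewrite !mxE /shear /shear_row /=.
have sgnS (x y : nat) : x.+1 = y -> (-1) ^+ y = - (-1) ^+ x :> R.
  by move=> <-; rewrite exprS mulN1r.
case: (a.+1 =P i) => [ai|_]; case: (b.+1 =P i) => [bi|_] /=.
- rewrite (sgnS (a + b).+1 (i + b).+1) -?ai //.
  rewrite (sgnS (a + b).+1 (a + a.+1).+1); last by lia.
  rewrite (sgnS (a + a.+1).+1 (a.+1 + a.+1).+1) // (sgnS (a + b).+1 (a + a.+1).+1); last by lia.
  by rewrite ai bi; ring.
- by rewrite (sgnS (a + b).+1 (i + b).+1) -?ai //; ring.
- rewrite (sgnS (a + b).+1 (a + i).+1) -?bi ?addnS //; ring.
- ring.
Qed.

(** The lower right block is the inverse transpose of the upper left one, which is why A changes by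
    a congruence. *)
Lemma xgen_shear n i (t : R) : (0 < i < n)%N ->
  xgen n i t = block_mx (1%:M + t *: superdiag n i) 0 0 (1%:M - t *: (superdiag n i)^T).
Proof.
move=> i_n; rewrite -[xgen _ _ _]submxK /xgen (_ : (i == n) = false); last by lia.
have eqP0 (b : bool) : ~~ b -> b%:R = 0 :> R by case: b.
congr block_mx; apply/matrixP => x y; have := ltn_ord x; have := ltn_ord y => yn xn;
  rewrite !mxE -!val_eqE /=.
- by rewrite eqSS [X in _ - _ * X]eqP0 ?mulr0 ?subr0 //; lia.
- by rewrite !eqP0 ?mulr0 ?subr0 ?addr0 //; lia.
- by rewrite !eqP0 ?mulr0 ?subr0 ?addr0 //; lia.
- rewrite eqn_add2l [X in _ + _ * X]eqP0 ?mulr0 ?addr0; last by lia.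
  by congr (_ - _ * _%:R); lia.
Qed.

Lemma xgen_pair n (t : R) : (1 < n)%N ->
  xgen n n t = block_mx 1%:M (signed_mx n (add_wedge n t (fun _ _ => 0))) 0 1%:M.
Proof.
move=> n1; rewrite -[xgen _ _ _]submxK /xgen eqxx.
have eqP0 (b : bool) : ~~ b -> b%:R = 0 :> R by case: b.
congr block_mx; apply/matrixP => x y; have := ltn_ord x; have := ltn_ord y => yn xn;
  rewrite !mxE -!val_eqE /=.
- by rewrite !(eqP0 (_ && _)) ?mulr0 ?subr0 ?addr0 //; lia.
- rewrite (eqP0 (_ == _)) ?add0r /add_wedge; last by lia.
  rewrite (_ : ((n + y).+1 == n + n)%N = (y.+1 == n)); last by lia.
  rewrite (_ : ((n + y).+1 == (n + n).-1)%N = (y.+1 == n.-1)); last by lia.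
  (* The nonzero entries lie where x + y is odd, so their sign factor is +1. *)
  have sgn_pair (c d : bool) : (c || d -> ~~ odd (x + y).+1) ->
      t * c%:R - t * d%:R = (-1) ^+ (x + y).+1 * (0 + t * c%:R - t * d%:R) :> R.
    rewrite -signr_odd; case: (odd _) => [|_]; last by rewrite expr0 mul1r add0r.
    by case: c d => [] [] => [/(_ isT)|/(_ isT)|/(_ isT)|_] //; rewrite /=; ring.
  apply: sgn_pair; lia.
- by rewrite !eqP0 ?mulr0 ?subr0 ?addr0 //; lia.
- by rewrite eqn_add2l !(eqP0 (_ && _)) ?mulr0 ?subr0 ?addr0 //; lia.
Qed.

End Link.

(** * The top rows of the product *)

Section Product.
Variable R : realFieldType.

Fixpoint xprod n (l : seq (nat * R)) : 'M[R]_(n + n) :=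
  if l is (i, t) :: l' then xprod n l' *m xgen n i t else 1%:M.

Lemma xprod_rcons n l u : xprod n (rcons l u) = xgen n u.1 u.2 *m xprod n l.
Proof.
elim: l => [|[i t] l IH] /=; first by case: u => i t /=; rewrite mulmx1 mul1mx.
by rewrite IH mulmxA.
Qed.

Lemma tp_prodE n (t : 'rV[R]_('C(n, 2))) :
  tp_prod t = xprod n (rev [seq (nth 0%N (tp_word n) k, t 0 k) | k : 'I_('C(n, 2))]).
Proof.
have -> : tp_prod t = \big[@mulmx R _ _ _ / 1%:M]_(k <- enum 'I_('C(n, 2)))
    xgen n (nth 0%N (tp_word n) k) (t 0 k) by rewrite /tp_prod enumT [index_enum _]unlock.
rewrite /image_mem; elim: (enum _) => [|k s IH] /=.
  by rewrite big_nil.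
by rewrite big_cons rev_cons xprod_rcons IH.
Qed.

(** The top rows keep the form [U | U A]: a factor diag(X, X^{-T}) gives
    [U X | U X (X^{-1} A X^{-T})], and the letter n adds its upper right block to A. *)
Lemma usubmx_xprod n (l : seq (nat * R)) : (1 < n)%N -> all (fun u => 0 < u.1 <= n)%N l ->
  exists2 U, U \in unitmx &
    usubmx (xprod n l) = row_mx U (U *m signed_mx n (run n l)).
Proof.
move=> n1; elim: l => [_|[i t] l IH] /=.
  exists 1%:M; rewrite ?unitmx1 // mul1mx scalar_mx_block /block_mx col_mxKu.
  by congr row_mx; apply/matrixP => a b; rewrite !mxE mulr0.
case/andP=> i_n /IH[U unitU E]; rewrite -mul_usub_mx E.
have [->|i_neq] := eqVneq i n.
  exists U => //; rewrite xgen_pair // mul_row_block !mulmx1 mulmx0 addr0 -mulmxDr.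
  congr (row_mx _ (_ *m _)); rewrite /step eqxx; apply/matrixP => a b.
  by rewrite !mxE /add_wedge; ring.
have lt_i : (i < n)%N by lia.
have unipotent (c : R) : (1%:M + c *: superdiag R n i) *m (1%:M - c *: superdiag R n i) = 1%:M.
  rewrite mulmxBr mulmx1 mulmxDl mul1mx -scalemxAl -scalemxAr superdiag_sqr //.
  by rewrite !scaler0 addr0 addrK.
exists (U *m (1%:M + t *: superdiag R n i)).
  by rewrite unitmx_mul unitU /=; case: (mulmx1_unit (unipotent t)).
rewrite xgen_shear; last by lia.
rewrite mul_row_block !mulmx0 addr0 add0r /step (negPf i_neq) signed_mx_shear //.
by rewrite -!mulmxA [(1%:M + t *: _) *m _]mulmxA unipotent mul1mx.
Qed.

End Product.

(** * From the parameters to the signs of the Pfaffians *)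

Lemma tp_word_letter n : (1 < n)%N -> all (fun i => 0 < i <= n)%N (tp_word n).
Proof.
move=> n1; have decrun_mem a b i : i \in decrun a b -> (b <= i <= a)%N.
  by rewrite /decrun; case: ltnP => // ab; rewrite mem_rev mem_iota; lia.
apply/allP => i /flattenP[_ /mapP[m + ->]]; rewrite mem_iota => m_n.
by rewrite mem_cat mem_cat inE => /or3P[/eqP->|/decrun_mem|/decrun_mem]; lia.
Qed.

Lemma Aparam_run (R : realFieldType) n (t : 'rV[R]_('C(n, 2))) : (1 < n)%N ->
  (forall k, 0 < t 0 k) ->
  exists l : seq (nat * R), [/\ all (fun u => 0 < u.2) l, unzip1 l = rev (tp_word n) &
    Aparam t = signed_mx n (run n l)].
Proof.
move=> n1 t_pos; set s := [seq (nth 0%N (tp_word n) k, t 0 k) | k : 'I_('C(n, 2))].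
have s1E : unzip1 s = tp_word n.
  rewrite /unzip1 -map_comp -[RHS](mkseq_nth 0%N) size_tp_word /mkseq -val_enum_ord -map_comp.
  exact: eq_map.
exists (rev s); split.
- by rewrite all_rev; apply/allP => _ /mapP[k _ ->] /=.
- by rewrite /unzip1 map_rev -/(unzip1 s) s1E.
have [|U unitU E] := @usubmx_xprod R n (rev s) n1.
  rewrite all_rev; apply/allP => u /mapP[k _ ->] /=.
  by apply: (allP (tp_word_letter n1)); rewrite mem_nth ?size_tp_word.
by rewrite /Aparam tp_prodE -/s E row_mxKl row_mxKr mulKmx.
Qed.

(** Each of the |I|/2 pairs contributes one factor -1, and each 0-based index i in I a factor
    (-1)^i. *)
Lemma pfI_signed (R : realFieldType) n (B : nat -> nat -> R) (I : {set 'I_n}) : ~~ odd #|I| ->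
  exists2 h, increasing_in n #|I| h &
    pfI (signed_mx n B) I = (-1) ^+ (#|I|./2 + \sum_(i in I) i) * pff #|I| B h.
Proof.
move=> eI; pose s := [seq nat_of_ord i | i <- enum I].
have sz : size s = #|I| by rewrite size_map -cardE.
have s_sorted : sorted ltn s.
  have := iota_ltn_sorted 0 n; rewrite -val_enum_ord; apply: subseq_sorted; first exact: ltn_trans.
  by apply: map_subseq; rewrite enumT; apply: filter_subseq.
exists (fun x => (nth 0%N s x).+1).
  split => [x xI|x y /andP[xy yI]] /=.
    have /mapP[i _ ->] : nth 0%N s x \in s by apply: mem_nth; rewrite sz.
    exact: ltn_ord.
  by rewrite ltnS; apply: (sorted_ltn_nth ltn_trans) => //; rewrite inE sz //; apply: ltn_trans yI.
have valE (x : 'I_#|I|) : enum_val x = nth 0%N s x :> nat.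
  by rewrite (nth_map (enum_val x)) -?cardE // -enum_val_nth.
rewrite exprD big_enum_val /= -prodrXr.
rewrite -pfaffian_scale //; congr pfaffian; apply/matrixP => x y.
by rewrite !mxE !valE -exprD exprS mulrA.
Qed.

Unset Implicit Arguments.

Theorem theorem1p5 (R : realFieldType) (n : nat) (hn : (2 <= n)%N)
  (A : 'M[R]_n) (hA : SSpos A) (I : {set 'I_n}) (hI : ~~ odd #|I|) :
  Num.sg (pfI A I) =
  (-1) ^ ((\sum_(i in I) (i.+1 : int)) - ('C(#|I|.+1, 2) : int)).
Proof.
have [t [t_pos ->]] := hA; have [l [l_pos l_word ->]] := Aparam_run hn t_pos.
have [h h_inc ->] := pfI_signed (run n l) hI.
have pf_pos : 0 < pff #|I| (run n l) h.
  by apply: pff_run_gt0 => //; rewrite l_word; apply: reach_tp_word.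
rewrite sgrM (gtr0_sg pf_pos) mulr1 sgrX sgrN sgr1.
have -> : \sum_(i in I) (i.+1 : int) = ((\sum_(i in I) i + #|I|)%N : int).
  by rewrite -sum1_card -big_split -(big_morph Posz PoszD (erefl _)); congr Posz;
    apply: eq_bigr => i _; rewrite /= addn1.
(* With |I| = 2q the binomial is q(2q + 1), of the parity of q; the shift to 1-based indices adds
   the even number |I|. *)
have binE : 'C(#|I|.+1, 2) = (#|I|./2 * #|I|.+1)%N.
  by rewrite bin2 /= -[in LHS](even_halfK hI) -doubleMr doubleK mulnC even_halfK.
rewrite expfzDr ?oppr_eq0 ?oner_eq0 // -exprnN invr_sign -exprnP -exprD binE.
rewrite -[LHS]signr_odd -[RHS]signr_odd; congr (_ ^+ nat_of_bool _).
by rewrite !oddD oddM /= (negPf hI) addbF andbT addbC.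
Qed.
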